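(* Let $H$ be a Hadamard manifold, $E\subseteq H$ a nonempty open geodesic convex set, let $\psi_u:E\to\mathbb{R}$, $u\in\{1,\dots,t\}$, be convex on $E$, $F=\{p\in E:\psi_u(p)\le0,\ u=1,\dots,t\}$, and let $\bar p\in F$. Suppose $\phi_s:E\to\mathbb{I}$ with $\phi_s(p)=[\phi_s^L(p),\phi_s^U(p)]$ are LU-convex and weakly directionally differentiable at $\bar p$ for $s\in\{1,\dots,l\}$. Assume $t\ge 2l$ and let $\{Q_1,\dots,Q_{2l}\}$ be a decomposition of $\{1,\dots,t\}$ into $2l$ nonempty pairwise disjoint subsets with union $\{1,\dots,t\}$. If there exist real numbers $\mu_u\ge0$, $u\in\{1,\dots,t\}$, such that for all $s\in\{1,\dots,l\}$ and all $p\in F$ (i) $(\phi_s^L)'(\bar p;\exp_{\bar p}^{-1}p)+\sum_{u\in Q_s}\mu_u\psi_u'(\bar p;\exp_{\bar p}^{-1}p)\ge0$; (ii) $(\phi_s^U)'(\bar p;\exp_{\bar p}^{-1}p)+\sum_{u\in Q_{s+l}}\mu_u\psi_u'(\bar p;\exp_{\bar p}^{-1}p)\ge0$; and (iii) $\mu_u\psi_u(\bar p)=0$ for $u\in\{1,\dots,t\}$, then $\bar p$ is a type-I Pareto optimal solution of the problem (MIVOP2) of minimizing $\phi=(\phi_1,\dots,\phi_l)$ over $F$.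
   Context: A Hadamard manifold $H$ is a complete simply connected Riemannian manifold of non-positive sectional curvature; for $p\in H$ the map $\exp_p:T_p(H)\to H$ is a diffeomorphism with inverse $\exp_p^{-1}$, and the geodesic joining $p$ to $q$ is $\gamma_{p,q}(\alpha)=\exp_p(\alpha\exp_p^{-1}q)$, $\alpha\in[0,1]$. A set $E\subseteq H$ is geodesic convex if $\gamma_{p,q}(\alpha)\in E$ for all $p,q\in E$, $\alpha\in[0,1]$. The integers $t,l$ are positive. For $f:E\to\mathbb{R}$, the directional derivative is $f'(p;w)=\lim_{\alpha\to0^+}\frac{f(\exp_p(\alpha w))-f(p)}{\alpha}$, $w\in T_p(H)$; $f$ is directionally differentiable at $p$ if it exists (finite) for all $w\in T_p(H)$. $f$ is convex at $p\in E$ if $f(\gamma_{p,q}(\alpha))\le\alpha f(q)+(1-\alpha)f(p)$ for all $q\in E$, $\alpha\in[0,1]$, and convex on $E$ if this holds at every $p\in E$. $\mathbb{I}$ is the set of closed bounded intervals of $\mathbb{R}$. For $T=[t^L,t^U]$, $S=[s^L,s^U]$: $T+S=[t^L+s^L,t^U+s^U]$, and $kT=[kt^L,kt^U]$ for $k\ge0$. $T\leqq_{LU}S$ iff $t^L\le s^L$ and $t^U\le s^U$; $T<_{LU}S$ means $T\leqq_{LU}S$ and $T\ne S$. For tuples of intervals, $T<_{LU}S$ means $T_k\leqq_{LU}S_k$ for all $k$ and $T_h<_{LU}S_h$ for at least one $h$. $f=[f^L,f^U]:E\to\mathbb{I}$ is weakly directionally differentiable at $p$ if $f^L$ and $f^U$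 are directionally differentiable at $p$; it is LU-convex at $p$ if $f(\gamma_{p,q}(\alpha))\leqq_{LU}(1-\alpha)f(p)+\alpha f(q)$ for all $q\in E$, $\alpha\in[0,1]$. $\bar p\in F$ is a type-I Pareto optimal solution of (MIVOP2) if there is no $\hat p\in F$ with $\phi(\hat p)<_{LU}\phi(\bar p)$. *)

(* Defs.v *)
From HB Require Import structures.
From mathcomp Require Import all_boot all_order all_algebra.
From mathcomp Require Import all_classical all_reals all_analysis.

Set Implicit Arguments.
Unset Strict Implicit.
Unset Printing Implicit Defensive.
Import Order.TTheory GRing.Theory Num.Theory.
Import numFieldNormedType.Exports.

Local Open Scope classical_set_scope.
Local Open Scope ring_scope.

Section smoothness.
Context {R : realType} {n : nat}.
Implicit Types (U : set 'rV[R]_n) (f : 'rV[R]_n -> R).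

Definition partial (a : 'I_n) f : 'rV[R]_n -> R := 'D_(delta_mx 0 a) f.

(* [U] is meant to be open. *)
Fixpoint Ck (k : nat) U f : Prop :=
  (forall x, U x -> {for x, continuous f}) /\
  if k is k'.+1 then
    forall a : 'I_n,
      (forall x, U x -> derivable f x (delta_mx 0 a)) /\ Ck k' U (partial a f)
  else True.

Definition smooth U f := forall k, Ck k U f.

Definition smooth_map U (F : 'rV[R]_n -> 'rV[R]_n) :=
  forall a : 'I_n, smooth U (fun x => F x 0 a).

End smoothness.

(* Smooth [n]-manifold with a Riemannian metric.  The atlas is indexed by
   [chart]; [coords i] is only relevant on [cdom i], and [param i] (its inverse)
   only on the image of [cdom i].  [metric i x] is the Gram matrix of the
   coordinate frame of chart [i] at the point of coordinates [x].  Vectors are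
   rows, so that the differential of [F] at [x] is [v |-> v *m 'J F x]. *)
Record riemannianManifold (R : realType) (n : nat) := RiemannianManifold {
  carrier :> topologicalType;
  hausdorffM : hausdorff_space carrier;
  second_countableM : @second_countable carrier;
  chart : Type;
  cdom : chart -> set carrier;
  coords : chart -> carrier -> 'rV[R]_n;
  param : chart -> 'rV[R]_n -> carrier;
  cdom_cover : forall p, exists i, cdom i p;
  cdom_open : forall i, open (cdom i);
  crange_open : forall i, open (coords i @` cdom i);
  chartK : forall i p, cdom i p -> param i (coords i p) = p;
  coords_continuous : forall i p, cdom i p -> {for p, continuous (coords i)};
  param_continuous : forall i x, (coords i @` cdom i) x ->
    {for x, continuous (param i)};
  transition_smooth : forall i j,
    smooth_map (coords i @` (cdom i `&` cdom j)) (coords j \o param i);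
  metric : chart -> 'rV[R]_n -> 'M[R]_n;
  metric_smooth : forall i a b,
    smooth (coords i @` cdom i) (fun x => metric i x a b);
  metric_sym : forall i x, (coords i @` cdom i) x -> (metric i x)^T = metric i x;
  metric_pos : forall i x, (coords i @` cdom i) x ->
    forall v : 'rV[R]_n, v != 0 -> 0 < (v *m metric i x *m v^T) 0 0;
  metric_compat : forall i j x, (coords i @` (cdom i `&` cdom j)) x ->
    metric i x = 'J (coords j \o param i) x
                 *m metric j (coords j (param i x))
                 *m ('J (coords j \o param i) x)^T
}.

Section riemannian.
Context {R : realType} {n : nat} {M : riemannianManifold R n}.
Implicit Types (p q : M) (i j : chart M) (x u v : 'rV[R]_n).

(* A tangent vector is the family of its components in all the charts around
   [p]; the value 0 in the other charts makes the representation unique. *)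
Definition tvector := chart M -> 'rV[R]_n.

Definition tangent p : set tvector := [set w |
  (forall i, ~ cdom i p -> w i = 0) /\
  (forall i j, cdom i p -> cdom j p ->
     w j = w i *m 'J (coords j \o param i) (coords i p))].

(* The Levi-Civita connection: coefficient of the [k]-th coordinate field in
   the covariant derivative of the [b]-th one along the [a]-th one. *)
Definition christoffel i (k a b : 'I_n) x : R :=
  2^-1 * \sum_(m < n) invmx (metric i x) k m *
    (partial a (fun y => metric i y b m) x
     + partial b (fun y => metric i y a m) x
     - partial m (fun y => metric i y a b) x).

(* Coefficient of the [d]-th coordinate field in R(d_a, d_b) d_c, where
   R(X, Y) Z = D_X D_Y Z - D_Y D_X Z - D_[X,Y] Z. *)
Definition curvature_coef i (a b c d : 'I_n) x : R :=
  partial a (christoffel i d b c) x - partial b (christoffel i d a c) x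
  + \sum_(e < n) (christoffel i e b c x * christoffel i d a e x
                  - christoffel i e a c x * christoffel i d b e x).

Definition inner i x u v : R := (u *m metric i x *m v^T) 0 0.

Definition curvature i x (u v w : 'rV[R]_n) : 'rV[R]_n :=
  \row_(d < n) \sum_(a < n) \sum_(b < n) \sum_(c < n)
    u 0 a * v 0 b * w 0 c * curvature_coef i a b c d x.

Definition sectional_curvature i x u v : R :=
  inner i x (curvature i x u v v) u /
  (inner i x u u * inner i x v v - inner i x u v ^+ 2).

Definition nonpositive_curvature := forall i p u v,
  cdom i p -> row_free (col_mx u v) ->
  sectional_curvature i (coords i p) u v <= 0.

Definition geodesic (c : R -> M) :=
  continuous c /\
  forall t i, cdom i (c t) ->
    let x := coords i \o c in
    [/\ \forall s \near t, derivable x s 1,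
        derivable (derive1 x) t 1 &
        forall k : 'I_n,
          derive1 (derive1 x) t 0 k
          + \sum_(a < n) \sum_(b < n)
              christoffel i k a b (x t) * derive1 x t 0 a * derive1 x t 0 b
          = 0].

Definition geodesic_from p (w : tvector) (c : R -> M) :=
  [/\ geodesic c, c 0 = p &
      forall i, cdom i p -> derive1 (coords i \o c) 0 = w i].

(* Equivalent to metric completeness by the Hopf-Rinow theorem. *)
Definition geodesically_complete :=
  forall p w, tangent p w -> exists c, geodesic_from p w c.

Definition rexp p (w : tvector) : M :=
  xget p [set q | exists2 c, geodesic_from p w c & q = c 1].

Definition rlog p q : tvector :=
  xget 0 [set w | tangent p w /\ rexp p w = q].

End riemannian.

Arguments nonpositive_curvature {R n} M.
Arguments geodesically_complete {R n} M.

Definition simply_connected (R : realType) (T : topologicalType) :=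
  [/\ [set: T] !=set0,
      forall p q : T, exists f : R -> T,
        [/\ {within `[0, 1], continuous f}, f 0 = p & f 1 = q] &
      forall f : R -> T, {within `[0, 1], continuous f} -> f 0 = f 1 ->
        exists h : R * R -> T,
          [/\ {within `[0, 1] `*` `[0, 1], continuous h},
              forall s, s \in `[0, 1] -> h (s, 0) = f s,
              forall s, s \in `[0, 1] -> h (s, 1) = f 0 &
              forall t, t \in `[0, 1] -> h (0, t) = f 0 /\ h (1, t) = f 0]].

(* [exp_bijective] follows from the other three conditions (Cartan-Hadamard);
   it is recorded here so that [rlog p] is by definition the inverse of
   [rexp p]. *)
Record hadamard (R : realType) (n : nat) (H : riemannianManifold R n) : Prop :=
  Hadamard {
    complete_hadamard : geodesically_complete H;
    simply_connected_hadamard : simply_connected R H;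
    nonpositive_hadamard : nonpositive_curvature H;
    exp_bijective : forall p : H, set_bij (tangent p) [set: H] (rexp p)
  }.

(* Functions on [E] are total functions whose values outside [E] are never
   used. *)
Section convexity.
Context {R : realType} {n : nat} {H : riemannianManifold R n}.
Implicit Types (E : set H) (p q : H) (f : H -> R).

Definition geodesic_between p q (a : R) : H := rexp p (a *: rlog p q).

Definition geodesic_convex E := forall p q, E p -> E q ->
  forall a : {i01 R}, E (geodesic_between p q a%:num).

Definition diff_quotient f p (w : tvector) (a : R) : R :=
  (f (rexp p (a *: w)) - f p) / a.

(* The limit is taken in the extended reals, where the difference quotients of
   a convex function always converge. *)
Definition dirderiv f p (w : @tvector R n H) : \bar R :=
  lim ((diff_quotient f p w a)%:E @[a --> 0^'+]).

Definition directionally_differentiable f p := forall w, tangent p w ->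
  exists d : R, diff_quotient f p w a @[a --> 0^'+] --> d.

Definition convex_at E f p := forall q, E q -> forall a : {i01 R},
  f (geodesic_between p q a%:num) <= a%:num * f q + (1 - a%:num) * f p.

Definition convex_on E f := forall p, E p -> convex_at E f p.

End convexity.

Section intervals.
Context {R : realType}.

Record cinterval := CInterval {
  lower : R;
  upper : R;
  lower_le_upper : lower <= upper
}.

Implicit Types S T : cinterval.

Definition iadd T S : cinterval :=
  CInterval (lerD (lower_le_upper T) (lower_le_upper S)).

Lemma iscale_subproof (k : {nonneg R}) T :
  k%:num * lower T <= k%:num * upper T.
Proof. by rewrite ler_wpM2l // lower_le_upper. Qed.

Definition iscale (k : {nonneg R}) T : cinterval :=
  CInterval (iscale_subproof k T).

Definition leLU T S := lower T <= lower S /\ upper T <= upper S.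

Definition ltLU T S := leLU T S /\ T <> S.

Definition ltLU_tuple (l : nat) (T S : 'I_l -> cinterval) :=
  (forall k, leLU (T k) (S k)) /\ (exists h, ltLU (T h) (S h)).

End intervals.

Arguments cinterval R : clear implicits.

Section interval_valued.
Context {R : realType} {n : nat} {H : riemannianManifold R n}.
Implicit Types (E F : set H) (p : H).

Definition weakly_directionally_differentiable (f : H -> cinterval R) p :=
  directionally_differentiable (lower \o f) p /\
  directionally_differentiable (upper \o f) p.

Definition LU_convex_at E (f : H -> cinterval R) p :=
  forall q, E q -> forall a : {i01 R},
    leLU (f (geodesic_between p q a%:num))
         (iadd (iscale (1 - a%:num)%:nng (f p)) (iscale a%:num%:nng (f q))).

Definition feasible (t : nat) E (psi : 'I_t -> H -> R) : set H :=
  [set p | E p /\ forall u, psi u p <= 0].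

Definition typeI_pareto (l : nat) F (phi : 'I_l -> H -> cinterval R) p :=
  F p /\ ~ exists2 q, F q & ltLU_tuple (phi^~ q) (phi^~ p).

End interval_valued.

Definition decomposition (t m : nat) (Q : 'I_m -> {set 'I_t}) :=
  [/\ forall k, Q k != finset.set0,
      forall j k, j != k -> (Q j :&: Q k)%SET = finset.set0 &
      forall u, exists k, u \in Q k].

(* Main.v *)
Require Import Defs.
From HB Require Import structures.
From mathcomp Require Import all_boot all_order all_algebra.
From mathcomp Require Import all_classical all_reals all_analysis.
From mathcomp Require Import lra.
Import Order.TTheory GRing.Theory Num.Theory.
Import numFieldNormedType.Exports.
Local Open Scope classical_set_scope.
Local Open Scope ring_scope.

(** A function that is convex at [p] has, along the geodesic from [p] to [q],
    difference quotients bounded by [f q - f p]; hence its directional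
    derivative in the direction [rlog p q] is at most [f q - f p]
    ([dirderiv_le]).  For the objectives the limit exists by hypothesis.  For
    the constraints it exists in the extended reals because the quotients are
    monotone ([is_cvg_diff_quotient_convex]); it may be -oo.  The bound needs
    this existence, since the limit operator returns an arbitrary value on a
    divergent function.

    Let [p] and [q] be feasible.  The bound for a constraint, multiplied by
    [mu u >= 0], gives [mu u * (psi u q - psi u p) = mu u * psi u q <= 0] by
    complementary slackness.  So the sum over any block of constraints in (i)
    or (ii) is nonpositive, and the remaining derivative of the endpoint
    function satisfies [0 <= f q - f p] ([KKT_le]).  Thus [pbar] minimizes all
    the [2l] endpoint functions over the feasible set separately, and a feasible
    [q] that LU-dominates it has [phi s q = phi s pbar] for every [s]. *)

Section radial_geodesics.
Context {R : realType} {n : nat} {H : riemannianManifold R n}.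
Hypothesis hH : hadamard H.
Implicit Types (p q : H) (w : @tvector R n H) (a b : R).

Lemma tangentZ p w a : tangent p w -> tangent p (a *: w).
Proof.
move=> [w0 wJ]; split=> [i /w0 wi0|i j pi pj]; rewrite !fctE.
  by rewrite wi0 scaler0.
by rewrite (wJ i j) // scalemxAl.
Qed.

Lemma rlogP p q : tangent p (rlog p q) /\ rexp p (rlog p q) = q.
Proof.
have [_ _ /(_ q I) [w tw wq]] := exp_bijective hH p.
by apply: (xgetPex 0 (P := [set w | tangent p w /\ rexp p w = q])); exists w.
Qed.

Lemma rexpK p w : tangent p w -> rlog p (rexp p w) = w.
Proof.
move=> tw; have [tl el] := rlogP p (rexp p w).
have [_ inj _] := exp_bijective hH p.
by apply: inj; rewrite ?inE.
Qed.

Lemma rlog_geodesic_between p q b :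
  rlog p (geodesic_between p q b) = b *: rlog p q.
Proof. by apply: rexpK; apply: tangentZ; have [] := rlogP p q. Qed.

End radial_geodesics.

Section convex_dirderiv.
Context {R : realType} {n : nat} {H : riemannianManifold R n}.
Hypothesis hH : hadamard H.
Variables (E : set H) (f : H -> R) (p : H).
Hypothesis f_convex : convex_at E f p.
Implicit Types (q : H) (a b : R).

Lemma diff_quotient_le q a : E q -> 0 < a -> a <= 1 ->
  diff_quotient f p (rlog p q) a <= f q - f p.
Proof.
move=> Eq a0 a1; rewrite /diff_quotient ler_pdivrMr //.
have := f_convex q Eq (Itv01 (ltW a0) a1).
rewrite /geodesic_between /= => h; lra.
Qed.

(** The geodesic to [geodesic_between p q b] is the initial part of the geodesic
    to [q], so this is [diff_quotient_le] at that point for the parameter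
    [a / b]. *)
Lemma diff_quotient_homo q a b : geodesic_convex E -> E p -> E q ->
  0 < a -> a <= b -> b <= 1 ->
  diff_quotient f p (rlog p q) a <= diff_quotient f p (rlog p q) b.
Proof.
move=> E_convex Ep Eq a0 ab b1; have b0 := lt_le_trans a0 ab.
have Eb : E (geodesic_between p q b) := E_convex p q Ep Eq (Itv01 (ltW b0) b1).
have ab0 : 0 < a / b by rewrite divr_gt0.
have ab1 : a / b <= 1 by rewrite ler_pdivrMr // mul1r.
have := diff_quotient_le _ _ Eb ab0 ab1.
rewrite rlog_geodesic_between // /diff_quotient scalerA.
rewrite divfK ?gt_eqF // invf_div mulrA (mulrAC _ b) => h.
by rewrite ler_pdivlMr.
Qed.

Lemma is_cvg_diff_quotient_convex q : geodesic_convex E -> E p -> E q ->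
  cvg ((diff_quotient f p (rlog p q) a)%:E @[a --> 0^'+]).
Proof.
move=> E_convex Ep Eq; apply/cvg_ex; eexists.
apply: (nondecreasing_at_right_cvge (BRight 1)); first by rewrite bnd_simp.
move=> a b; rewrite !in_itv /= => /andP[a0 _] /andP[_ b1] ab.
by rewrite lee_fin diff_quotient_homo.
Qed.

Lemma dirderiv_le q : E q ->
  cvg ((diff_quotient f p (rlog p q) a)%:E @[a --> 0^'+]) ->
  (dirderiv f p (rlog p q) <= (f q - f p)%:E)%E.
Proof.
move=> Eq cv; apply: lime_le => //; near=> a.
rewrite lee_fin; apply: diff_quotient_le => //.
by near: a; exact: nbhs_right_le.
Unshelve. all: by end_near. Qed.

Lemma is_cvg_diff_quotient_differentiable q : directionally_differentiable f p ->
  cvg ((diff_quotient f p (rlog p q) a)%:E @[a --> 0^'+]).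
Proof.
have [tq _] := rlogP hH p q.
move=> /(_ _ tq) [d qd]; apply/cvg_ex; exists d%:E.
by apply: cvg_EFin => //; exact: nearW.
Qed.

End convex_dirderiv.

(** Each endpoint of each objective has its own block [A] of constraints and its
    own inequality (i) or (ii), so the endpoints can be treated one at a time as
    scalar objectives [f]. *)
Lemma KKT_le (R : realType) (n : nat) (H : riemannianManifold R n)
    (hH : hadamard H) (E : set H) (E_convex : geodesic_convex E)
    (t : nat) (psi : 'I_t -> H -> R) (psi_convex : forall u, convex_on E (psi u))
    (mu : 'I_t -> R) (mu_ge0 : forall u, 0 <= mu u) (A : {set 'I_t})
    (f : H -> R) (p q : H) :
  convex_at E f p -> directionally_differentiable f p ->
  (forall u, mu u * psi u p = 0) -> E p -> feasible E psi q ->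
  (0 <= dirderiv f p (rlog p q)
        + \sum_(u in A) (mu u)%:E * dirderiv (psi u) p (rlog p q))%E ->
  f p <= f q.
Proof.
move=> f_convex f_diff slack Ep [Eq psiq].
have cvgf := is_cvg_diff_quotient_differentiable hH f p q f_diff.
have /= df_le := dirderiv_le _ _ _ f_convex _ Eq cvgf.
have dpsi_le u : ((mu u)%:E * dirderiv (psi u) p (rlog p q) <= 0)%E.
  have cvgpsi :=
    is_cvg_diff_quotient_convex hH _ _ _ (psi_convex u p Ep) _ E_convex Ep Eq.
  apply: le_trans (lee_wpmul2l _ (dirderiv_le _ _ _ (psi_convex u p Ep) _ Eq cvgpsi)) _.
    by rewrite lee_fin.
  by rewrite -EFinM lee_fin mulrBr slack subr0 mulr_ge0_le0.
move=> /le_trans /(_ (leeD df_le (sume_le0 (fun u _ => dpsi_le u) _))).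
by rewrite adde0 lee_fin subr_ge0.
Qed.

Lemma leLU_anti (R : realType) (T S : cinterval R) :
  leLU T S -> leLU S T -> T = S.
Proof.
case: T S => [a b ab] [c d cd] [/= ac bd] [/= ca db].
have eac : a = c by apply/le_anti/andP.
have ebd : b = d by apply/le_anti/andP.
by subst c d; congr CInterval; exact: bool_irrelevance.
Qed.

Theorem theorem3p3 (R : realType) (n : nat) (H : riemannianManifold R n)
    (hH : hadamard H) (E : set H) (E_nonempty : E !=set0) (E_open : open E)
    (E_convex : geodesic_convex E)
    (t l : nat) (t_gt0 : (0 < t)%N) (l_gt0 : (0 < l)%N)
    (psi : 'I_t -> H -> R) (psi_convex : forall u, convex_on E (psi u))
    (pbar : H) (pbarF : feasible E psi pbar)
    (phi : 'I_l -> H -> cinterval R)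
    (phi_convex : forall s, LU_convex_at E (phi s) pbar)
    (phi_diff : forall s, weakly_directionally_differentiable (phi s) pbar)
    (t_ge : (2 * l <= t)%N)
    (Q : 'I_(l + l) -> {set 'I_t}) (Q_decomp : decomposition Q)
    (hmu : exists mu : 'I_t -> R,
      [/\ forall u, 0 <= mu u,
          forall s p, feasible E psi p ->
            (0 <= dirderiv (lower \o phi s) pbar (rlog pbar p)
                  + \sum_(u in Q (lshift l s))
                      (mu u)%:E * dirderiv (psi u) pbar (rlog pbar p))%E,
          forall s p, feasible E psi p ->
            (0 <= dirderiv (upper \o phi s) pbar (rlog pbar p)
                  + \sum_(u in Q (rshift l s))
                      (mu u)%:E * dirderiv (psi u) pbar (rlog pbar p))%E &
          forall u, mu u * psi u pbar = 0]) :
  typeI_pareto (feasible E psi) phi pbar.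
Proof.
case: hmu => mu [mu_ge0 dlower dupper slack].
split=> // -[q Fq [q_le [h [_ q_neq]]]].
have [Ep _] := pbarF; have [lower_diff upper_diff] := phi_diff h.
apply/q_neq/(leLU_anti _ _ _ (q_le h)); split.
- apply: (KKT_le _ _ _ hH _ E_convex _ _ psi_convex _ mu_ge0 _ _ _ _ _ lower_diff slack Ep Fq)
    (dlower h q Fq).
  by move=> r Er a; have [+ _] := phi_convex h r Er a; rewrite /= addrC.
- apply: (KKT_le _ _ _ hH _ E_convex _ _ psi_convex _ mu_ge0 _ _ _ _ _ upper_diff slack Ep Fq)
    (dupper h q Fq).
  by move=> r Er a; have [_ +] := phi_convex h r Er a; rewrite /= addrC.
Qed.
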